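(* Let $p$ be an odd prime, $m>2$, $\mathbb{M}=\mathbb{F}_{p^m}$, and let $p'$ be a $p$-primitive divisor of $p^m-1$. For $i\in\{1,2\}$ let $1\le k_i,l_i\le m$, $q_i=p^{k_i}$, $r_i=p^{l_i}$, and let $\mathbb{P}_i=(\mathbb{M}\times\mathbb{M},+,\ast_i)$ be a $(q_i,r_i)$-biprojective pre-semifield. Assume that $k_1\not\equiv\pm l_1\pmod m$, that $k_1\not\equiv 0$ and $l_1\not\equiv 0\pmod m$, and (if $m$ is even) that $k_1\not\equiv m/2$ and $l_1\not\equiv m/2\pmod m$. Assume moreover that $C_{\mathbb{P}_1}$ contains $Z^{(q_1,r_1)}$ as a subgroup of index $I$ with $p'\nmid I$. If $\mathbb{P}_1$ and $\mathbb{P}_2$ are isotopic, then there exist an isotopism $\gamma=(N,L,M)$ from $\mathbb{P}_1$ to $\mathbb{P}_2$ and an integer $0\le t\le m-1$ such that: - all non-zero subfunctions of $N$, $L$ and $M$ are monomials; - all non-zero subfunctions of $L$ and $M$ have the same degree $p^t$; - either $k_1\equiv\pm k_2$ and $l_1\equiv\pm l_2\pmod m$, or $k_1\equiv\pm l_2$ and $l_1\equiv\pm k_2\pmod m$ (all signs independent). More precisely, one of the following two cases holds. (A) $N_2=N_3=0$ and $N_1,N_4\neq0$; $k_1\equiv\pm k_2$ and $l_1\equiv\pm l_2\pmod m$; if $k_1\equiv k_2$ (resp. $l_1\equiv l_2$) $\pmod m$ then $N_1$ (resp. $N_4$) is a monomial of degree $p^t$; if $k_1\equiv-k_2$ (resp.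 $l_1\equiv-l_2$) $\pmod m$ then $N_1$ (resp. $N_4$) is a monomial of degree $p^{t+k_2}$ (resp. $p^{t+l_2}$). (B) $N_1=N_4=0$ and $N_2,N_3\neq0$; $k_1\equiv\pm l_2$ and $l_1\equiv\pm k_2\pmod m$; if $k_1\equiv l_2$ (resp. $l_1\equiv k_2$) $\pmod m$ then $N_3$ (resp. $N_2$) is a monomial of degree $p^t$; if $k_1\equiv-l_2$ (resp. $l_1\equiv-k_2$) $\pmod m$ then $N_3$ (resp. $N_2$) is a monomial of degree $p^{t+l_2}$ (resp. $p^{t+k_2}$).
   Context: A pre-semifield $\mathbb{P}=(P,+,\ast)$ is a finite group $(P,+)$ with a multiplication $\ast$ that is left and right distributive and satisfies: $x\ast y=0$ implies $x=0$ or $y=0$. With $q=p^k$, $r=p^l$, $1\le k,l\le m$, a $(q,r)$-biprojective mapping of $\mathbb{M}\times\mathbb{M}$ is a map $F(x,y)=(f(x,y),g(x,y))$ with $f=a_0x^{q+1}+b_0x^qy+c_0xy^q+d_0y^{q+1}$, $g=a_1x^{r+1}+b_1x^ry+c_1xy^r+d_1y^{r+1}$, coefficients in $\mathbb{M}$. Its polarization is $\Delta_F(X,U)=F(X+U)-F(X)-F(U)$, and $F$ is planar if $\Delta_F(X,U)=0$ with $U\ne0$ forces $X=0$. A $(q,r)$-biprojective pre-semifield is $(\mathbb{M}\times\mathbb{M},+,\ast)$ with $X\ast U=\Delta_F(X,U)$ for a planar $(q,r)$-biprojective $F$. Let $\mathrm{GL}(\mathbb{F})$ be the group of $\mathbb{F}_p$-linear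 bijections of $\mathbb{M}\times\mathbb{M}$. An isotopism from $\mathbb{P}_1$ to $\mathbb{P}_2$ is a triple $(N,L,M)\in\mathrm{GL}(\mathbb{F})^3$ with $N(X\ast_1U)=L(X)\ast_2M(U)$ for all $X,U$; $\mathbb{P}_1,\mathbb{P}_2$ are isotopic if one exists. $\mathrm{Aut}(\mathbb{P})$ is the group (under componentwise composition) of isotopisms from $\mathbb{P}$ to itself. Every $\mathbb{F}_p$-linear $L:\mathbb{M}^2\to\mathbb{M}^2$ is written $L=\begin{pmatrix}L_1&L_2\\L_3&L_4\end{pmatrix}$, i.e. $L(x,y)=(L_1(x)+L_2(y),L_3(x)+L_4(y))$ with $L_i\in\mathrm{End}_{\mathbb{F}_p}(\mathbb{M})$; the $L_i$ are the subfunctions of $L$. Each subfunction is written uniquely as a linearized polynomial $\sum_{j=0}^{m-1}b_jx^{p^j}$; it is a monomial of degree $p^j$ if it equals $bx^{p^j}$ with $b\ne0$. Exponents of $p$ in degrees are read modulo $m$. A $p$-primitive divisor of $p^m-1$ is a prime $p'$ with $p'\mid p^m-1$ and $p'\nmid p^i-1$ for $1\le i\le m-1$ (it exists for $p$ odd, $m>2$). For $a\in\mathbb{M}^\times$ let $m_a$ be multiplication by $a$ on $\mathbb{M}$ and $$\gamma_a=(\mathrm{diag}(m_{a^{q+1}},m_{a^{r+1}}),\mathrm{diag}(m_a,m_a),\mathrm{diag}(m_a,m_a))\in\mathrm{GL}(\mathbb{F})^3.$$ Let $Z^{(q,r)}=\{\gamma_a:a\in\mathbb{M}^\times\}$, let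 $R$ be the unique Sylow $p'$-subgroup of $\mathbb{M}^\times$, and $Z_R^{(q,r)}=\{\gamma_a:a\in R\}$; both are subgroups of $\mathrm{Aut}(\mathbb{P})$ for every $(q,r)$-biprojective pre-semifield $\mathbb{P}$. For such $\mathbb{P}$, $C_{\mathbb{P}}$ is the centralizer of $Z_R^{(q,r)}$ in $\mathrm{Aut}(\mathbb{P})$. *)

(* Defs.v *)
From HB Require Import structures.
From mathcomp Require Import all_boot all_order all_algebra all_fingroup all_solvable.

Set Implicit Arguments.
Unset Strict Implicit.
Unset Printing Implicit Defensive.

Import GRing.Theory.
Local Open Scope ring_scope.

(* MathComp does not declare the product of two finite Z-modules as one. *)
HB.saturate prod.

Record presemifield (P : finZmodType) := Presemifield {
  pmul :> P -> P -> P;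
  pmulDl : forall x y z, pmul (x + y) z = pmul x z + pmul y z;
  pmulDr : forall x y z, pmul x (y + z) = pmul x y + pmul x z;
  pmul_eq0 : forall x y, pmul x y = 0 -> x = 0 \/ y = 0
}.

(* k = - l modulo m *)
Definition opp_mod (m k l : nat) : bool := (k + l == 0 %[mod m])%N.
Definition pm_mod (m k l : nat) : bool := (k == l %[mod m])%N || opp_mod m k l.

Definition primitive_divisor (p m p' : nat) : Prop :=
  [/\ prime p', (p' %| p ^ m - 1)%N
    & forall i, (1 <= i <= m.-1)%N -> ~~ (p' %| p ^ i - 1)%N].

Section Biprojective.

Variable M : finFieldType.
Notation V := (M * M)%type.

Definition biprojective_form (q : nat) (a b c d : M) (X : V) : M :=
  a * X.1 ^+ q.+1 + b * (X.1 ^+ q * X.2) + c * (X.1 * X.2 ^+ q)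
  + d * X.2 ^+ q.+1.

Definition biprojective (q r : nat) (F : V -> V) : Prop :=
  exists a0 b0 c0 d0 a1 b1 c1 d1 : M, forall X,
    F X = (biprojective_form q a0 b0 c0 d0 X, biprojective_form r a1 b1 c1 d1 X).

Definition polarization (F : V -> V) (X U : V) : V := F (X + U) - F X - F U.

Definition planar (F : V -> V) : Prop :=
  forall X U, U != 0 -> polarization F X U = 0 -> X = 0.

Definition biprojective_presemifield (q r : nat) (P : presemifield V) : Prop :=
  exists F : V -> V,
    [/\ biprojective q r F, planar F & forall X U, P X U = polarization F X U].

(* When M has characteristic p, a class a of 'F_p acts on M * M as u |-> u *+ a,
   so the condition below is F_p-linearity. *)
Definition GL (p : nat) : {set {perm V}} :=
  [set s : {perm V} | [forall a : 'F_p, forall u, forall v,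
     s (u *+ a + v) == s u *+ a + s v]].

Definition isotopism (p : nat) (P1 P2 : presemifield V)
    (g : {perm V} * {perm V} * {perm V}) : bool :=
  let: (N, L, T) := g in
  [&& N \in GL p, L \in GL p, T \in GL p
    & [forall X, forall U, N (P1 X U) == P2 (L X) (T U)]].

Definition isotopic (p : nat) (P1 P2 : presemifield V) : Prop :=
  exists g, isotopism p P1 P2 g.

(* The product of permutations in MathComp is composition in diagrammatic
   order, so this is the opposite of the group of autotopisms for the usual
   composition; subgroups, centralizers and indices are the same for both. *)
Definition autotopisms (p : nat) (P : presemifield V) :
    {set {perm V} * {perm V} * {perm V}} :=
  [set g | isotopism p P P g].

Lemma GL1 p : 1%g \in GL p.
Proof.
by rewrite inE; apply/'forall_forallP => a u; apply/forallP => v; rewrite !perm1.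
Qed.

Lemma GLM p s t : s \in GL p -> t \in GL p -> (s * t)%g \in GL p.
Proof.
rewrite !inE => /'forall_forallP sP /'forall_forallP tP.
apply/'forall_forallP => a u; apply/forallP => v; rewrite !permM.
by rewrite (eqP (forallP (sP a u) v)) (eqP (forallP (tP a _) _)).
Qed.

Lemma autotopism_group_set p P : group_set (autotopisms p P).
Proof.
apply/group_setP; split=> [|[[N L] T] [[N' L'] T']].
  rewrite inE /isotopism /= !GL1 /=.
  by apply/'forall_forallP => X U; rewrite !perm1.
rewrite !inE => /and4P[GN GL' GT /'forall_forallP E].
move=> /and4P[GN' GL'' GT' /'forall_forallP E'].
rewrite /isotopism /= !GLM //=.
by apply/'forall_forallP => X U; rewrite !permM (eqP (E _ _)) (eqP (E' _ _)).
Qed.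

Canonical autotopism_group p P := Group (autotopism_group_set p P).

Definition diag_fun (c d : {unit M}) (X : V) : V := (val c * X.1, val d * X.2).

Lemma diag_fun_inj c d : injective (diag_fun c d).
Proof.
move=> [x y] [x' y'] [/(mulrI (valP c)) -> /(mulrI (valP d)) ->] //.
Qed.

(* diag(m_c, m_d) *)
Definition diag (c d : {unit M}) : {perm V} := perm (@diag_fun_inj c d).

Definition gamma (q r : nat) (a : {unit M}) : {perm V} * {perm V} * {perm V} :=
  (diag (a ^+ q.+1)%g (a ^+ r.+1)%g, diag a a, diag a a).

Lemma diagM c d c' d' : diag (c * c')%g (d * d')%g = (diag c d * diag c' d')%g.
Proof.
apply/permP => -[x y]; rewrite permM !permE /diag_fun /=.
by rewrite !mulrA ![_ * val c]mulrC ![_ * val d]mulrC.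
Qed.

Lemma gammaM q r : {in [set: {unit M}] &, {morph gamma q r : a b / (a * b)%g}}.
Proof.
move=> a b _ _; have cab : commute a b.
  by apply/val_inj; rewrite /= mulrC.
by rewrite /gamma !expgMn // !diagM.
Qed.

Canonical gamma_morphism q r := Morphism (@gammaM q r).

Definition Z_gamma (q r : nat) (A : {set {unit M}}) := (gamma q r @* A)%g.

(* The centralizer C_P is obtained when R is the Sylow p'-subgroup of the group
   of units of M. *)
Definition C_gamma (p q r : nat) (R : {set {unit M}}) (P : presemifield V) :=
  ('C_(autotopisms p P)(Z_gamma q r R))%g.

Definition sub1 (L : V -> V) (x : M) : M := (L (x, 0)).1.
Definition sub2 (L : V -> V) (y : M) : M := (L (0, y)).1.
Definition sub3 (L : V -> V) (x : M) : M := (L (x, 0)).2.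
Definition sub4 (L : V -> V) (y : M) : M := (L (0, y)).2.

(* As maps on a field with p ^ m elements, x |-> b * x ^+ (p ^ j) only depends
   on j modulo m, so j need not be reduced. *)
Definition monomial (p j : nat) (f : M -> M) : Prop :=
  exists2 b : M, b != 0 & forall x, f x = b * x ^+ (p ^ j).

Definition zero_fun (f : M -> M) : Prop := forall x, f x = 0.

Definition all_subfunctions (Q : (M -> M) -> Prop) (L : V -> V) : Prop :=
  [/\ Q (sub1 L), Q (sub2 L), Q (sub3 L) & Q (sub4 L)].

Definition nonzero_monomials (p : nat) (L : V -> V) : Prop :=
  all_subfunctions (fun f => ~ zero_fun f -> exists j, monomial p j f) L.

Definition nonzero_monomials_deg (p t : nat) (L : V -> V) : Prop :=
  all_subfunctions (fun f => ~ zero_fun f -> monomial p t f) L.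

End Biprojective.

(* Main.v *)
Require Import Defs.
From HB Require Import structures.
From mathcomp Require Import all_boot all_order all_algebra all_fingroup all_solvable.
From mathcomp Require Import finfield ring.

Set Implicit Arguments.
Unset Strict Implicit.
Unset Printing Implicit Defensive.

Import GRing.Theory.
Local Open Scope ring_scope.

(** An isotopism can be replaced by one that carries a small torus of [P1] onto
    that of [P2], and such an isotopism is forced to be monomial.

    Sylow part.  Let [R] be the Sylow [p']-subgroup of the units of [M] and [Z_R]
    its image under [gamma].  A [p']-element of the autotopism group that
    normalizes [Z_R] acts on the scalars of [R] by a power of Frobenius
    ([eigen_semilinear]), hence its [m]-th power centralizes [Z_R]; as [p'] is
    prime to [m], the element itself does.  By the hypothesis on the index,
    [Z_R] is a Sylow subgroup of its centralizer, therefore of its normalizer,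
    therefore of the whole autotopism group of [P1] ([Sylow_gamma]).  An isotopism
    transports the torus of [P2] into the autotopisms of [P1], where Sylow's
    theorem conjugates it into [Z_R].  So some isotopism [(N, L, T)] satisfies
    [gamma a * (N, L, T) = (N, L, T) * gamma b] with [a] of order divisible by
    [p'] ([intertwining_isotopism]).

    Monomials.  A subfunction [f] of [N], [L] or [T] then satisfies an equation
    [f (c * x) = d * f x].  Every additive [f] is a linearized polynomial
    ([additive_linearized]), and comparison of coefficients gives
    [d = c ^+ (p ^ j)] for each degree [p ^ j] that occurs in [f].  If the [m]
    conjugates of [c] are distinct, only one degree occurs ([eigen_monomial]).
    For [L] and [T] one has [c = a] and [d = b], so that all degrees are the same
    [p ^ t].  For [N] one has [c = a ^+ (p ^ k1).+1] or [a ^+ (p ^ l1).+1], whose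
    order is divisible by [p'] since [2 k1] and [2 l1] are not [0] modulo [m].

    Degrees.  Restricted to the lines through [X] and [U], a component of [P1]
    is [A * x ^+ q * u + A' * x * u ^+ q].  In [N (P1 X U) = P2 (L X) (T U)] both
    sides are combinations of monomials [x ^+ (p ^ i) * u ^+ (p ^ j)], which are
    independent for distinct [(i, j)] modulo [m].  The difference [i - j] is
    [+- k1] or [+- l1] on the left, and the hypotheses on [k1] and [l1] make these
    four values distinct, so nothing cancels; on the right it is [+- k2] or
    [+- l2] according to the component ([line_form_degree]).  So [N] cannot mix
    its two inputs in one output, which leaves the diagonal and the antidiagonal
    shape. *)

(** * Additive maps of a finite field as linearized polynomials *)

Section LinearizedPolynomials.

Variables (p m : nat) (M : finFieldType).
Hypotheses (p_pr : prime p) (m_gt1 : (1 < m)%N) (cardM : #|M| = (p ^ m)%N).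

Lemma frobD j (x y : M) : (x + y) ^+ (p ^ j) = x ^+ (p ^ j) + y ^+ (p ^ j).
Proof.
apply: exprDn_pchar; rewrite pnatX; apply/orP; left.
by rewrite pnatE //; apply: card_finPcharP cardM p_pr.
Qed.

Lemma frob0 j : (0 : M) ^+ (p ^ j) = 0.
Proof. by rewrite expr0n gtn_eqF ?expn_gt0 ?prime_gt0. Qed.

Lemma frob_card (x : M) : x ^+ (p ^ m) = x.
Proof. by rewrite -cardM expf_card. Qed.

Lemma frob_mod j (x : M) : x ^+ (p ^ (j %% m)) = x ^+ (p ^ j).
Proof.
rewrite {2}(divn_eq j m) addnC expnD exprM mulnC.
elim: (j %/ m)%N => [|n IH]; first by rewrite muln0 expr1.
by rewrite mulnS expnD mulnC exprM -IH frob_card.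
Qed.

Lemma eq_frob i j (x : M) : i = j %[mod m] -> x ^+ (p ^ i) = x ^+ (p ^ j).
Proof. by move=> eij; rewrite -frob_mod eij frob_mod. Qed.

(** The Frobenius conjugates of [a] are [m] distinct elements. *)
Definition full_orbit (a : M) :=
  forall i j, a ^+ (p ^ i) = a ^+ (p ^ j) -> i = j %[mod m].

Lemma full_orbit_neq0 a : full_orbit a -> a != 0.
Proof.
move=> a_full; apply/eqP => a0; have := a_full 0 1.
by rewrite a0 !frob0 mod0n modn_small // => /(_ erefl).
Qed.

(** The exponent [p ^ i * (p ^ (j - i) - 1)] annihilates [a] when its conjugates
    of index [i] and [j] coincide; [d] divides it and is prime to [p ^ i],
    so that [j = i]. *)
Lemma order_full_orbit d (a : {unit M}) :
  (forall n, (n < m)%N -> (d %| p ^ n - 1)%N -> n = 0%N) -> (d %| #[a]%g)%N ->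
  coprime d p -> full_orbit (val a).
Proof.
move=> dP da cdp i j.
wlog le_ij : i j / (i %% m <= j %% m)%N => [IH|].
  by case/orP: (leq_total (i %% m) (j %% m)) => ? ?; [apply: IH | apply/esym/IH].
rewrite -(frob_mod i) -(frob_mod j); move: le_ij (ltn_pmod j (ltnW m_gt1)).
set i' := (i %% m)%N; set j' := (j %% m)%N => le_ij lt_jm.
rewrite -!FinRing.val_unitX => /val_inj/eqP; rewrite eq_sym => E.
apply/eqP; rewrite eqn_leq le_ij /= -subn_eq0; apply/eqP.
apply: dP; first exact: leq_ltn_trans (leq_subr _ _) lt_jm.
rewrite -(@Gauss_dvdr d (p ^ i')) ?coprimeXr //; apply: dvdn_trans da _.
rewrite mulnBr muln1 -expnD subnKC // -eqn_mod_dvd ?leq_pexp2l ?prime_gt0 //.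
by rewrite -eq_expg_mod_order.
Qed.

Lemma exists_full_orbit : exists a : M, full_orbit a.
Proof.
have /cyclicP[a defG] := field_unit_group_cyclic [set: {unit M}].
have oa : #[a]%g = (p ^ m).-1.
  by rewrite /order -defG card_finField_unit cardM.
have pX_gt0 n : (0 < p ^ n)%N by rewrite expn_gt0 prime_gt0.
exists (val a); apply: (order_full_orbit _ (dvdnn _)); rewrite oa.
  move=> n lt_nm; have [//|n_gt0] := posnP n; move/dvdn_leq.
  rewrite subn_gt0 -{1}(expn0 p) ltn_exp2l ?prime_gt1 // => /(_ n_gt0).
  by rewrite -subn1 leq_subLR subnKC // leq_exp2l ?prime_gt1 // leqNgt lt_nm.
rewrite -(@coprime_pexpr m) ?(ltnW m_gt1) //.
exact: coprimePn.
Qed.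

(** The coefficient of [x ^+ (p ^ t)] in [f]: the maps [z |-> z ^+ (p ^ t)], for
    [t < m], are distinct characters of the multiplicative group, hence
    orthogonal, and the order of that group is [-1] in [M].  The term [z = 0]
    vanishes. *)
Definition coef t (f : M -> M) : M := - \sum_z z ^+ (p ^ t) * f z^-1.

Lemma eq_coef t f g : f =1 g -> coef t f = coef t g.
Proof. by move=> fg; congr (- _); apply: eq_bigr => z _; rewrite fg. Qed.

Lemma coefD t f g : coef t (fun x => f x + g x) = coef t f + coef t g.
Proof.
rewrite /coef -opprD -big_split; congr (- _).
by apply: eq_bigr => z _; rewrite mulrDr.
Qed.

Lemma coefZ t c f : coef t (fun x => c * f x) = c * coef t f.
Proof.
rewrite /coef mulrN mulr_sumr; congr (- _).
by apply: eq_bigr => z _; rewrite mulrCA.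
Qed.

Lemma coef_comp_mul t a f :
  a != 0 -> coef t (fun x => f (a * x)) = a ^+ (p ^ t) * coef t f.
Proof.
move=> a0; rewrite /coef mulrN mulr_sumr; congr (- _).
rewrite (reindex_inj (mulfI a0)) /=; apply: eq_bigr => z _.
by rewrite exprMn mulrA invfM mulVKf.
Qed.

Lemma coef_frob t j : coef t (fun x => x ^+ (p ^ j)) = (j == t %[mod m])%:R.
Proof.
have [a a_full] := exists_full_orbit.
(* Substituting a * x multiplies the coefficient by two powers of a, which differ
   unless j and t agree modulo m. *)
have := coef_comp_mul t (fun x => x ^+ (p ^ j)) (full_orbit_neq0 a_full).
rewrite (eq_coef _ (fun x => exprMn _ a x)) coefZ.
have [/eqP ejt _|njt /eqP] := boolP (j == t %[mod m])%N; last first.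
  rewrite -subr_eq0 -mulrBl mulf_eq0 subr_eq0 => /orP[/eqP/a_full/eqP|/eqP//].
  by rewrite (negPf njt).
rewrite /coef (bigD1 0) //= frob0 mul0r add0r.
rewrite (eq_bigr (fun=> 1)) => [|z z0]; last first.
  by rewrite (eq_frob _ ejt) -exprMn divff ?expr1n.
rewrite sumr_const cardC1 cardM -subn1 natrB ?expn_gt0 ?prime_gt0 //.
have p_char := card_finPcharP cardM p_pr.
by rewrite natrX (pcharf0 p_char) expr0n gtn_eqF 1?ltnW //= sub0r opprK.
Qed.

(** The polynomial ['X^p - 'X] already has the [p] roots [n%:R], [n < p]. *)
Lemma fix_frob_nat (c : M) : c ^+ p = c -> exists n, c = n%:R.
Proof.
move=> cp; pose s : seq M := [seq n%:R | n <- iota 0 p].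
suff /mapP[n _ ->] : c \in s by exists n.
have p_char := card_finPcharP cardM p_pr.
apply: contraT => c_s.
have s_uniq : uniq s.
  rewrite map_inj_in_uniq ?iota_uniq // => i j; rewrite !mem_iota !add0n.
  wlog le_ij : i j / (i <= j)%N => [IH ip jp|/= ip jp /eqP].
    by case/orP: (leq_total i j) => ? ?; [apply: IH | apply/esym/IH].
  rewrite eq_sym -subr_eq0 -natrB // -(dvdn_pcharf p_char).
  rewrite -eqn_mod_dvd // !modn_small //.
  by move/eqP->.
have sizeP : size ('X^p - 'X : {poly M}) = p.+1.
  by rewrite size_polyDl size_polyXn // size_polyN size_polyX ltnS prime_gt1.
have := @max_poly_roots _ ('X^p - 'X : {poly M}) (c :: s).
rewrite sizeP /= size_map size_iota ltnn c_s s_uniq -size_poly_eq0 sizeP => H.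
apply: H => //; rewrite rootE !hornerE cp subrr eqxx /=.
apply/allP => _ /mapP[n _ ->]; rewrite rootE !hornerE.
by rewrite -(pFrobenius_autE p_char) rmorph_nat subrr.
Qed.

(** With [Tr z = \sum_(t < m) z ^+ (p ^ t)], the sum on the right is
    [- \sum_z Tr z * f (x / z)].  The traces lie in the prime field, over which
    [f] is linear, so this is [f (- (\sum_z Tr z / z) * x)]; and
    [\sum_z Tr z / z = - 1] by orthogonality, only [t = 0] contributing. *)
Lemma additive_linearized f : {morph f : x y / x + y} ->
  forall x, f x = \sum_(t < m) coef t f * x ^+ (p ^ t).
Proof.
move=> fD x.
have f0 : f 0 = 0 by apply: (@addrI _ (f 0)); rewrite -fD !addr0.
have fN y : f (- y) = - f y by apply: (@addrI _ (f y)); rewrite -fD !subrr.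
have fMn n y : f (n%:R * y) = n%:R * f y.
  rewrite !mulr_natl; elim: n => [|n IH]; first by rewrite !mulr0n.
  by rewrite !mulrS fD IH.
have [->|x0] := eqVneq x 0.
  by rewrite f0 big1 // => t _; rewrite frob0 mulr0.
pose Tr (z : M) := \sum_(t < m) z ^+ (p ^ t).
have Tr_nat z : exists n, Tr z = n%:R.
  apply: fix_frob_nat; apply/eqP; rewrite -subr_eq0 -[p in _ ^+ p](expn1 p).
  rewrite /Tr (big_morph _ (@frobD 1) (frob0 1)) -sumrB.
  under eq_bigr => t _ do rewrite -exprM -expnD addn1.
  rewrite -(big_mkord xpredT (fun t => z ^+ (p ^ t.+1) - z ^+ (p ^ t))).
  by rewrite telescope_sumr // frob_card expr1 subrr.
have -> : \sum_(t < m) coef t f * x ^+ (p ^ t)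
          = \sum_(t < m) coef t (fun y => f (x * y)).
  by apply: eq_bigr => t _; rewrite coef_comp_mul // mulrC.
rewrite /coef sumrN exchange_big /=.
under eq_bigr => z _ do rewrite -mulr_suml -/(Tr z).
have -> : \sum_z Tr z * f (x * z^-1) = f (x * \sum_z Tr z * z^-1).
  rewrite mulr_sumr (big_morph _ fD f0); apply: eq_bigr => z _.
  by have [n ->] := Tr_nat z; rewrite mulrCA fMn.
rewrite -fN -mulrN; congr f; rewrite -[LHS]mulr1; congr (_ * _).
under eq_bigr => z _ do rewrite mulr_suml.
rewrite exchange_big -sumrN (bigD1 (Ordinal (ltnW m_gt1))) //=.
rewrite [X in _ + X]big1 ?addr0.
  transitivity (coef 0 (fun y => y ^+ (p ^ 0))); first by rewrite coef_frob eqxx.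
  by congr (- _); apply: eq_bigr => z _; rewrite expr1.
move=> t t0; transitivity (coef t (fun y => y ^+ (p ^ 0))).
  by congr (- _); apply: eq_bigr => z _; rewrite expr1.
rewrite coef_frob mod0n modn_small // eq_sym.
by rewrite (negPf (t0 : (t != 0 :> nat)%N)).
Qed.

(** The equation multiplies the coefficient of degree [p ^ t] by
    [a ^+ (p ^ t)] on one side and by [b] on the other. *)
Lemma eigen_monomial f a b : {morph f : x y / x + y} -> full_orbit a ->
  (forall x, f (a * x) = b * f x) -> ~ zero_fun f ->
  exists t, [/\ (t < m)%N, b = a ^+ (p ^ t) & monomial p t f].
Proof.
move=> fD a_full fa f_neq0; have fE := additive_linearized fD.
have key t : coef t f != 0 -> b = a ^+ (p ^ t).
  move=> ct; apply: (mulIf ct).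
  by rewrite -coef_comp_mul ?full_orbit_neq0 // (eq_coef _ fa) coefZ.
have [t /= ct|c0] := pickP (fun t : 'I_m => coef t f != 0); last first.
  case: f_neq0 => x; rewrite fE big1 // => t _.
  by have /negPn/eqP-> := c0 t; rewrite mul0r.
exists t; split; rewrite ?(key t) //; exists (coef t f) => // x.
rewrite {1}fE (bigD1 t) //= big1 ?addr0 // => i ni.
have [->|/key] := eqVneq (coef i f) 0; first by rewrite mul0r.
rewrite (key t) // => /a_full; rewrite !modn_small // => e.
by case/eqP: ni; apply: val_inj.
Qed.

(** * Independence of the monomials in two variables *)

Definition coef2 s t (B : M -> M -> M) := coef s (fun x => coef t (B x)).

Lemma coef2D s t B C :
  coef2 s t (fun x u => B x u + C x u) = coef2 s t B + coef2 s t C.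
Proof. by rewrite /coef2 -coefD; apply: eq_coef => x; rewrite coefD. Qed.

Lemma coef2_frob s t c i j :
  coef2 s t (fun x u => c * (x ^+ (p ^ i) * u ^+ (p ^ j)))
  = c *+ ((i == s %[mod m]) && (j == t %[mod m]))%N.
Proof.
rewrite /coef2 (_ : coef s _ = coef s (fun x =>
    (c * (j == t %[mod m])%N%:R) * x ^+ (p ^ i))).
  rewrite coefZ coef_frob -mulrA -natrM mulr_natr.
  by rewrite [(_ * _)%N]mulnC mulnb.
apply: eq_coef => x; rewrite coefZ coefZ coef_frob.
by rewrite -mulrA [X in _ * X]mulrC.
Qed.

(** Comparison of the coefficients of [x ^+ (p ^ (k + i)) * u ^+ (p ^ i)].  The
    first hypothesis keeps the terms in [l] from contributing, the second one
    the term with coefficient [b]; so [a] has to come from [A] or [B], which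
    are the two alternatives.  If [a = 0], exchange [x] and [u]. *)
Lemma degree_match k l k2 i j t (a b a' b' A B : M) :
  ~~ pm_mod m k l -> ~~ opp_mod m k k -> a != 0 \/ b != 0 ->
  (forall x u,
     a * (x ^+ (p ^ (k + i)) * u ^+ (p ^ i))
     + b * (x ^+ (p ^ i) * u ^+ (p ^ (k + i)))
     + (a' * (x ^+ (p ^ (l + j)) * u ^+ (p ^ j))
        + b' * (x ^+ (p ^ j) * u ^+ (p ^ (l + j))))
     = A * (x ^+ (p ^ (k2 + t)) * u ^+ (p ^ t))
       + B * (x ^+ (p ^ t) * u ^+ (p ^ (k2 + t)))) ->
  (k == k2 %[mod m])%N && (i == t %[mod m])%N
  || opp_mod m k k2 && (i == t + k2 %[mod m])%N.
Proof.
move=> nkl nkk.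
wlog a0 : a b a' b' A B / a != 0 => [IH [a0|b0] E|_ E].
- by apply: (IH a b a' b' A B) => //; left.
- apply: (IH b a b' a' B A) => //; first by left.
  move=> x u; have := E u x.
  by rewrite !(mulrC (u ^+ _)) addrC [X in X + _]addrC [RHS]addrC => <-; ring.
have [kl kl'] : (k == l %[mod m])%N = false /\ opp_mod m k l = false.
  by move: nkl; rewrite /pm_mod negb_or => /andP[/negPf-> /negPf->].
have key : coef2 (k + i) i (fun x u =>
     a * (x ^+ (p ^ (k + i)) * u ^+ (p ^ i))
     + b * (x ^+ (p ^ i) * u ^+ (p ^ (k + i)))
     + (a' * (x ^+ (p ^ (l + j)) * u ^+ (p ^ j))
        + b' * (x ^+ (p ^ j) * u ^+ (p ^ (l + j)))))
    = coef2 (k + i) i (fun x u => A * (x ^+ (p ^ (k2 + t)) * u ^+ (p ^ t))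
       + B * (x ^+ (p ^ t) * u ^+ (p ^ (k2 + t)))).
  by apply: eq_coef => x; apply: eq_coef => u; apply: E.
have sw c d : (c == d %[mod m])%N = (d == c %[mod m])%N by rewrite eq_sym.
move: key; rewrite !coef2D !coef2_frob !eqxx mulr1n.
have -> : ((i == k + i %[mod m]) && (k + i == i %[mod m]))%N = false.
  apply: contraNF nkk => /andP[h _]; move: h.
  rewrite -{1}(add0n i) eqn_modDr /opp_mod sw => /eqP h.
  by rewrite -modnDml h mod0n add0n h mod0n.
have -> : ((l + j == k + i %[mod m]) && (j == i %[mod m]))%N = false.
  apply: contraFF kl => /andP[/eqP h /eqP h'].
  by rewrite -(eqn_modDr i) -h -(modnDmr l) h' modnDmr.
have -> : ((j == k + i %[mod m]) && (l + j == i %[mod m]))%N = false.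
  apply: contraFF kl' => /andP[/eqP h h'].
  by rewrite /opp_mod -(eqn_modDr i) add0n (addnC k) -addnA -(modnDmr l) -h modnDmr.
rewrite !mulr0n !addr0; case: andP => [[h /eqP h'] _|_].
  apply/orP; left; rewrite h' eqxx andbT.
  by rewrite -(eqn_modDr i) -(eqP h) -(modnDmr k2) h' modnDmr.
rewrite mulr0n add0r; case: andP => [[/eqP h /eqP h'] _|_ /eqP]; last first.
  by rewrite mulr0n (negPf a0).
apply/orP; right; apply/andP; split; last by rewrite (addnC t) h'.
rewrite /opp_mod -(eqn_modDr i) add0n addnAC addnC -(modnDmr k2) -h modnDmr.
by rewrite h'.
Qed.

(** * Subfunctions of linear bijections of the plane *)

Notation V := (M * M)%type.

Definition lscale (a : M) (X : V) : V := (a * X.1, a * X.2).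

Definition semilinear t (L : V -> V) :=
  forall x X, L (lscale x X) = lscale (x ^+ (p ^ t)) (L X).

Lemma zero_fun_or (f : M -> M) : zero_fun f \/ ~ zero_fun f.
Proof.
by case: (boolP [forall x, f x == 0]) => [/forallP f0|/forallP f0];
   [left => x; apply/eqP | right => f0'; apply: f0 => x; rewrite f0'].
Qed.

Lemma eigen_power f a b : {morph f : x y / x + y} -> full_orbit a ->
  (forall x, f (a * x) = b * f x) -> exists c j, forall x, f x = c * x ^+ (p ^ j).
Proof.
move=> fD a_full fa; have [f0|] := zero_fun_or f.
  by exists 0, 0%N => x; rewrite mul0r.
by case/(eigen_monomial fD a_full fa) => j [_ _ [c _ fE]]; exists c, j.
Qed.

Section Additive.

Variable L : {perm V}.
Hypothesis L_GL : L \in GL M p.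

Lemma GL_additive : {morph L : X Y / X + Y}.
Proof.
move=> X Y; move: L_GL; rewrite inE => /forallP/(_ 1)/forallP/(_ X)/forallP/(_ Y).
by rewrite (_ : nat_of_ord (1 : 'F_p) = 1%N) // !mulr1n => /eqP.
Qed.

Lemma GL0 : L 0 = 0.
Proof. by apply: (@addrI _ (L 0)); rewrite -GL_additive !addr0. Qed.

Lemma GL_sub : [/\ {morph sub1 L : x y / x + y}, {morph sub2 L : x y / x + y},
  {morph sub3 L : x y / x + y} & {morph sub4 L : x y / x + y}].
Proof.
have D1 (x y : M) : (x + y, 0) = (x, 0) + (y, 0) :> V by congr pair; rewrite addr0.
have D2 (x y : M) : (0, x + y) = (0, x) + (0, y) :> V by congr pair; rewrite addr0.
by split=> x y; rewrite /sub1 /sub2 /sub3 /sub4 (D1, D2) GL_additive.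
Qed.

Lemma GL_subE X : L X = (sub1 L X.1 + sub2 L X.2, sub3 L X.1 + sub4 L X.2).
Proof.
case: X => x y; have -> : (x, y) = (x, 0) + (0, y) :> V.
  by congr pair; rewrite ?addr0 ?add0r.
by rewrite GL_additive /= !addr0 !add0r [LHS]surjective_pairing.
Qed.

Lemma GL_neq0 (X : V) : X != 0 -> L X != 0.
Proof. by apply: contraNN => /eqP LX; apply/eqP/(@perm_inj _ L); rewrite LX GL0. Qed.

Lemma GL_sub_eigen (c d c' d' : M) :
  (forall X, L (c * X.1, d * X.2) = (c' * (L X).1, d' * (L X).2)) ->
  [/\ forall x, sub1 L (c * x) = c' * sub1 L x,
      forall x, sub2 L (d * x) = c' * sub2 L x,
      forall x, sub3 L (c * x) = d' * sub3 L x
    & forall x, sub4 L (d * x) = d' * sub4 L x].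
Proof.
move=> LE; rewrite /sub1 /sub2 /sub3 /sub4.
by split=> x; [have := LE (x, 0) | have := LE (0, x) | have := LE (x, 0)
  | have := LE (0, x)]; rewrite /= mulr0 => ->.
Qed.

(** All non-zero subfunctions satisfy the same equation [f (a * x) = b * f x],
    hence have the same degree, determined by [b]. *)
Lemma eigen_semilinear a b : full_orbit a ->
  (forall X, L (lscale a X) = lscale b (L X)) ->
  exists t, [/\ (t < m)%N, b = a ^+ (p ^ t), semilinear t L
              & nonzero_monomials_deg p t L].
Proof.
move=> a_full La; have [D1 D2 D3 D4] := GL_sub.
have [E1 E2 E3 E4] := GL_sub_eigen La.
have [t lt_tm bE] : exists2 t, (t < m)%N & b = a ^+ (p ^ t).
  have [f1|] := zero_fun_or (sub1 L); last first.
    by case/(eigen_monomial D1 a_full E1) => t [? ? _]; exists t.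
  have [f3|] := zero_fun_or (sub3 L); last first.
    by case/(eigen_monomial D3 a_full E3) => t [? ? _]; exists t.
  have /GL_neq0/eqP[] : (1, 0) != 0 :> V.
    by rewrite -pair_eqE /= oner_eq0.
  have [D10 D20 D30 D40] : [/\ sub1 L 0 = 0, sub2 L 0 = 0, sub3 L 0 = 0 & sub4 L 0 = 0].
    by rewrite /sub1 /sub2 /sub3 /sub4 [L _]GL0.
  by rewrite GL_subE /= f1 f3 D20 D40 addr0.
have mon f : {morph f : x y / x + y} -> (forall x, f (a * x) = b * f x) ->
    ~ zero_fun f -> monomial p t f.
  move=> fD fa /(eigen_monomial fD a_full fa)[j [lt_jm]].
  by rewrite bE => /a_full; rewrite !modn_small // => ->.
have semi f : {morph f : x y / x + y} -> (forall x, f (a * x) = b * f x) ->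
    forall x y, f (x * y) = x ^+ (p ^ t) * f y.
  move=> fD fa x y; have [f0|/(mon _ fD fa)[c _ fE]] := zero_fun_or f.
    by rewrite !f0 mulr0.
  by rewrite !fE exprMn mulrCA.
exists t; split=> //; last by split; apply: mon.
move=> x X; rewrite !GL_subE /lscale /= (semi _ D1) // (semi _ D2) //.
by rewrite (semi _ D3) // (semi _ D4) // -!mulrDr.
Qed.

End Additive.

(** * Biprojective products restricted to pairs of lines *)

(** A restriction to two lines shows the exponents of a biprojective form without
    its coefficients, and semilinear maps send lines to lines. *)
Definition line_form k (B : V -> V -> M) := forall X U, exists A A', forall x u,
  B (lscale x X) (lscale u U)
  = A * (x ^+ (p ^ k) * u) + A' * (x * u ^+ (p ^ k)).

Lemma biprojective_line_form k l (P : presemifield V) :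
  biprojective_presemifield (p ^ k) (p ^ l) P ->
  line_form k (fun X U => (P X U).1) /\ line_form l (fun X U => (P X U).2).
Proof.
have form_line j (a b c d : M) : line_form j (fun X U =>
    biprojective_form (p ^ j) a b c d (X + U) - biprojective_form (p ^ j) a b c d X
    - biprojective_form (p ^ j) a b c d U).
  move=> [x1 x2] [u1 u2].
  exists (a * (x1 ^+ (p ^ j) * u1) + b * (x1 ^+ (p ^ j) * u2)
          + c * (x2 ^+ (p ^ j) * u1) + d * (x2 ^+ (p ^ j) * u2)).
  exists (a * (x1 * u1 ^+ (p ^ j)) + b * (u1 ^+ (p ^ j) * x2)
          + c * (x1 * u2 ^+ (p ^ j)) + d * (x2 * u2 ^+ (p ^ j))) => x u.
  rewrite /biprojective_form /= !exprSr !frobD !exprMn.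
  by move: (p ^ j)%N => q; ring.
case=> F [[a0 [b0 [c0 [d0 [a1 [b1 [c1 [d1 FE]]]]]]]] _ PE]; split=> X U.
  have [A [A' E]] := form_line k a0 b0 c0 d0 X U.
  by exists A, A' => x u; rewrite PE /polarization !FE /= -E.
have [A [A' E]] := form_line l a1 b1 c1 d1 X U.
by exists A, A' => x u; rewrite PE /polarization !FE /= -E.
Qed.

(** A pair [(X, U)] with [B X U != 0] gives lines on which a coefficient of [B]
    is non-zero. *)
Lemma line_form_degree k l k2 i j t (B B' C : V -> V -> M) (c c' : M) (L T : V -> V) :
  ~~ pm_mod m k l -> ~~ opp_mod m k k ->
  line_form k B -> line_form l B' -> line_form k2 C ->
  semilinear t L -> semilinear t T ->
  (exists X, exists U, B X U != 0) -> c != 0 ->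
  (forall X U, c * B X U ^+ (p ^ i) + c' * B' X U ^+ (p ^ j) = C (L X) (T U)) ->
  (k == k2 %[mod m])%N && (i == t %[mod m])%N
  || opp_mod m k k2 && (i == t + k2 %[mod m])%N.
Proof.
move=> nkl nkk BP B'P CP Ls Ts [X [U BXU]] c0 E.
have [A1 [A2 BE]] := BP X U; have [A1' [A2' B'E]] := B'P X U.
have [C1 [C2 CE]] := CP (L X) (T U).
apply: (@degree_match k l k2 i j t (c * A1 ^+ (p ^ i)) (c * A2 ^+ (p ^ i))
          (c' * A1' ^+ (p ^ j)) (c' * A2' ^+ (p ^ j)) C1 C2) => //.
  have: A1 != 0 \/ A2 != 0.
    apply/orP; rewrite -negb_and; apply: contraNN BXU => /andP[/eqP A10 /eqP A20].
    have := BE 1 1; rewrite A10 A20 !mul0r addr0 /lscale !mul1r -!surjective_pairing.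
    by move->.
  by case=> h; [left | right]; rewrite mulf_neq0 // expf_neq0.
move=> x u; have := E (lscale x X) (lscale u U).
rewrite Ls Ts CE BE B'E !frobD !exprMn -!exprM -!expnD.
rewrite (addnC t k2) => <-; ring.
Qed.

(** If one component vanished, the other one would give an injection
    [X |-> P X U] of the plane into [M]. *)
Lemma presemifield_components (P : presemifield V) :
  (exists X, exists U, (P X U).1 != 0) /\ (exists X, exists U, (P X U).2 != 0).
Proof.
have key (h g : V -> M) : (forall v w, h v = h w -> g v = g w -> v = w) ->
    exists X, exists U, g (P X U) != 0.
  move=> hg; case: (boolP [exists X, exists U, g (P X U) != 0]) => [|nex].
    by case/existsP => X /existsP[U]; exists X, U.
  pose U : V := (1, 0).
  have U0 : U != 0 by rewrite -pair_eqE /= oner_eq0.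
  have gP X Y : g (P X Y) = 0.
    by move/existsPn: nex => /(_ X)/existsPn/(_ Y)/negPn/eqP.
  suff /leq_card : injective (fun X : V => h (P X U)).
    rewrite card_prod -{3}(muln1 #|M|) leq_pmul2l; last by rewrite cardM expn_gt0 prime_gt0.
    by rewrite leqNgt finNzRing_gt1.
  move=> X Y hXY; have := hg (P X U) (P Y U) hXY; rewrite !gP => /(_ erefl) PXY.
  have : P (X - Y) U = 0.
    apply: (@addIr _ (P Y U)); rewrite -pmulDl subrK add0r; exact: PXY.
  case/pmul_eq0 => [/eqP|/eqP]; first by rewrite subr_eq0 => /eqP.
  by rewrite (negPf U0).
split; [apply: (key snd fst) | apply: (key fst snd)] => //.
  by case=> ? ? [? ?] /= -> ->.
by case=> ? ? [? ?] /= -> ->.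
Qed.

End LinearizedPolynomials.

(** * Arithmetic of primitive divisors *)

Section PrimitiveDivisor.

Variables (p m p' : nat).
Hypotheses (p_pr : prime p) (m_gt1 : (1 < m)%N).
Hypothesis p'P : primitive_divisor p m p'.

Lemma primitive_divisor_dvd n : (p' %| p ^ n - 1)%N -> (m %| n)%N.
Proof.
case: p'P => p'_pr p'm p'i; have pX j : (1 <= p ^ j)%N by rewrite expn_gt0 prime_gt0.
rewrite -eqn_mod_dvd // {1}(divn_eq n m) expnD mulnC expnM.
have pm1 : (p ^ m == 1 %[mod p'])%N by rewrite eqn_mod_dvd.
rewrite -modnMmr -(expnM p) (mulnC _ m) expnM -modnXm (eqP pm1) modnXm exp1n modnMmr muln1.
rewrite eqn_mod_dvd // => h; rewrite /dvdn; apply: contraT; rewrite -lt0n => n0.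
by have := p'i (n %% m)%N; rewrite n0 -ltnS prednK ?ltn_pmod ?(ltnW m_gt1) // h => /(_ isT).
Qed.

Lemma primitive_divisor_coprime : coprime p' p.
Proof.
case: p'P => p'_pr p'm _; rewrite prime_coprime //; apply/negP => p'p.
have /dvdn_sub/(_ p'm) : (p' %| p ^ m)%N.
  by rewrite -(prednK (ltnW m_gt1)) expnS dvdn_mulr.
rewrite subnBA ?expn_gt0 ?prime_gt0 // addKn dvdn1 => /eqP p'1.
by move: p'_pr; rewrite p'1.
Qed.

(** By Fermat, the order [m] of [p] modulo [p'] divides [p' - 1], so [m < p']. *)
Lemma primitive_divisor_coprime_exponent : coprime p' m.
Proof.
case: p'P => p'_pr p'm _; have p'1 := prime_gt1 p'_pr.
have /primitive_divisor_dvd : (p' %| p ^ p'.-1 - 1)%N.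
  rewrite -eqn_mod_dvd ?expn_gt0 ?prime_gt0 // -(totient_prime p'_pr).
  by rewrite Euler_exp_totient // coprime_sym primitive_divisor_coprime.
move=> mp'; rewrite prime_coprime // gtnNdvd ?(ltnW m_gt1) //.
apply: leq_ltn_trans (dvdn_leq _ mp') _; first by rewrite -ltnS (ltn_predK p'1).
by rewrite ltn_predL ltnW.
Qed.

(** Since [p ^ k + 1] divides [p ^ (2 k) - 1], a common factor [p'] would force
    [m] to divide [2 k]. *)
Lemma primitive_divisor_expS k : ~~ opp_mod m k k -> coprime p' (p ^ k).+1.
Proof.
case: p'P => p'_pr _ _; rewrite prime_coprime //; apply: contraNN => p'k.
rewrite /opp_mod mod0n; apply: primitive_divisor_dvd.
by rewrite addnn -muln2 expnM -[X in (_ - X)%N](exp1n 2) subn_sqr dvdn_mull ?addn1.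
Qed.

End PrimitiveDivisor.

(** * The torus as a Sylow subgroup of the autotopism group *)

Section Autotopisms.

Variables (p m p' : nat) (M : finFieldType).
Notation V := (M * M)%type.
Hypotheses (p_pr : prime p) (m_gt1 : (1 < m)%N) (cardM : #|M| = (p ^ m)%N).
Hypothesis p'P : primitive_divisor p m p'.

Lemma diagE (c d : {unit M}) X : diag c d X = (val c * X.1, val d * X.2).
Proof. by rewrite permE. Qed.

Lemma diag_GL (c d : {unit M}) : diag c d \in GL M p.
Proof.
rewrite inE; apply/'forall_forallP => n X; apply/forallP => Y; rewrite !diagE.
case: X Y => x1 x2 [y1 y2]; apply/eqP.
have pairMn (u : V) (j : nat) : u *+ j = (u.1 *+ j, u.2 *+ j).
  elim: j => [|j IH]; first by rewrite !mulr0n.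
  by rewrite !mulrS IH.
by rewrite !pairMn /=; congr pair => /=; rewrite mulrDr mulrnAr.
Qed.

Lemma gamma_autotopism k l (P : presemifield V) a :
  biprojective_presemifield (p ^ k) (p ^ l) P ->
  gamma (p ^ k) (p ^ l) a \in autotopisms p P.
Proof.
case=> F [[a0 [b0 [c0 [d0 [a1 [b1 [c1 [d1 FE]]]]]]]] _ PE].
rewrite inE /isotopism /gamma !diag_GL /=; apply/'forall_forallP => X U.
have Fa Y : F (val a * Y.1, val a * Y.2)
    = (val a ^+ (p ^ k).+1 * (F Y).1, val a ^+ (p ^ l).+1 * (F Y).2).
  rewrite !FE /= /biprojective_form /= !exprSr !exprMn.
  by move: (p ^ k)%N (p ^ l)%N => q r; congr pair; ring.
rewrite !PE !diagE !FinRing.val_unitX /polarization.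
have -> : (val a * X.1, val a * X.2) + (val a * U.1, val a * U.2)
    = (val a * (X + U).1, val a * (X + U).2) :> V.
  by congr pair; rewrite -mulrDr.
by rewrite !Fa; apply/eqP; congr pair; rewrite /= !mulrBr.
Qed.

(** The form in which the commutation with the torus is used: equivariance of the
    three maps under multiplication by scalars. *)
Lemma gamma_intertwine q r q' r' (a b : {unit M}) (N L T : {perm V}) :
  (gamma q r a * (N, L, T) = (N, L, T) * gamma q' r' b)%g ->
  [/\ forall X, N (val a ^+ q.+1 * X.1, val a ^+ r.+1 * X.2)
        = (val b ^+ q'.+1 * (N X).1, val b ^+ r'.+1 * (N X).2),
      forall X, L (lscale (val a) X) = lscale (val b) (L X)
    & forall X, T (lscale (val a) X) = lscale (val b) (T X)].
Proof.
case=> EN EL ET; split=> X.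
- by have /permP/(_ X) := EN; rewrite !permM !diagE !FinRing.val_unitX.
- by have /permP/(_ X) := EL; rewrite !permM !diagE.
- by have /permP/(_ X) := ET; rewrite !permM !diagE.
Qed.

Lemma GLV (s : {perm V}) : s \in GL M p -> (s^-1)%g \in GL M p.
Proof.
rewrite !inE => /'forall_forallP sP; apply/'forall_forallP => n X; apply/forallP => Y.
apply/eqP/(@perm_inj _ s); rewrite permKV.
by have /forallP/(_ ((s^-1)%g Y))/eqP-> := sP n ((s^-1)%g X); rewrite !permKV.
Qed.

Lemma isotopismV (P1 P2 : presemifield V) g :
  isotopism p P1 P2 g -> isotopism p P2 P1 (g^-1)%g.
Proof.
case: g => -[N L] T /and4P[GN GL GT /'forall_forallP E].
apply/and4P; split; try exact: GLV.
apply/'forall_forallP => X U; rewrite -(inj_eq (@perm_inj _ N)) permKV.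
by rewrite (eqP (E _ _)) !permKV.
Qed.

Lemma isotopismM (P1 P2 P3 : presemifield V) g h :
  isotopism p P1 P2 g -> isotopism p P2 P3 h -> isotopism p P1 P3 (g * h)%g.
Proof.
case: g h => -[N L] T [[N' L'] T'] /and4P[GN GL GT /'forall_forallP E].
case/and4P => GN' GL' GT' /'forall_forallP E'.
apply/and4P; split; try exact: GLM.
by apply/'forall_forallP => X U; rewrite !permM (eqP (E _ _)) (eqP (E' _ _)).
Qed.

Variable R : {group {unit M}}.
Hypothesis R_Sylow : (p'.-Sylow([set: {unit M}]) R)%g.

Lemma Sylow_units_generator :
  exists a, R = <[a]>%G /\ (p' %| #[a]%g)%N.
Proof.
have /cyclicP[a Ra] := field_unit_group_cyclic R.
exists a; split; first exact/val_inj.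
case: p'P => p'_pr p'm _.
rewrite /order -Ra (card_Hall R_Sylow) card_finField_unit cardM -subn1.
by rewrite p_part -{1}(expn1 p') dvdn_exp2l // logn_gt0 mem_primes p'_pr p'm subn_gt0
  -{1}(expn0 p) ltn_exp2l ?prime_gt1 // ltnW.
Qed.

Lemma primitive_full_orbit (a : {unit M}) : (p' %| #[a]%g)%N -> full_orbit p m (val a).
Proof.
move=> p'a; apply: (order_full_orbit p_pr m_gt1 cardM _ p'a).
  move=> n lt_nm /(primitive_divisor_dvd p_pr m_gt1 p'P).
  by rewrite /dvdn modn_small // => /eqP.
exact: (primitive_divisor_coprime p_pr m_gt1 p'P).
Qed.

(** It suffices that [Z_R] is Sylow in its normalizer.  Let [S] be a Sylow
    [p']-subgroup of the normalizer with [Z_R] inside [S]: each of its elements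
    raises the generator of [Z_R] to a power [p ^ t], so that its [m]-th power
    commutes with that generator.  As [p'] is prime to [m], the group [S] is in
    the centralizer, where [Z_R] is already Sylow. *)
Lemma Sylow_gamma q r (P : presemifield V) :
  Z_gamma q r [set: {unit M}] \subset C_gamma p q r R P ->
  ~~ (p' %| #|C_gamma p q r R P : Z_gamma q r [set: {unit M}]|%g)%N ->
  (p'.-Sylow(autotopisms p P) (Z_gamma q r R))%g.
Proof.
case: (p'P) => p'_pr _ _ sZC p'I.
have [a [Ra p'a]] := Sylow_units_generator.
pose A := autotopism_group p P.
pose Z := (gamma_morphism M q r @* [set: {unit M}])%G.
pose ZR := (gamma_morphism M q r @* R)%G.
pose C := 'C_A(ZR)%G.
have ZR_Sylow_Z : (p'.-Sylow(Z) ZR)%g by apply: morphim_pSylow R_Sylow; apply: subsetT.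
have sZRZ : ZR \subset Z by apply: pHall_sub ZR_Sylow_Z.
have ZR_Sylow_C : (p'.-Sylow(C) ZR)%g.
  have sZC' : Z \subset C := sZC.
  rewrite pHallE (subset_trans sZRZ) //= (card_Hall ZR_Sylow_Z).
  rewrite -(Lagrange sZC') partnM // ?indexg_gt0 //.
  by rewrite [X in (_ * X)%N]part_p'nat ?muln1 // p'natE.
have ZRa : ZR = <[gamma q r a]>%G.
  by apply/val_inj; rewrite /= Ra (morphim_cycle (gamma_morphism M q r)) ?inE.
change (p'.-Sylow(A) ZR)%g; rewrite -Sylow_subnorm.
have sCN : C \subset 'N_A(ZR)%g by rewrite setIS ?cent_sub.
have [S SylS sZRS] := Sylow_superset (subset_trans (pHall_sub ZR_Sylow_C) sCN)
  (pHall_pgroup ZR_Sylow_C).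
suff sSC : S \subset C.
  have eS := sub_pHall ZR_Sylow_C (pHall_pgroup SylS) sZRS sSC.
  by move: SylS; rewrite eS.
apply/subsetP => g gS; have /setIP[gA gN] := subsetP (pHall_sub SylS) g gS.
have p'g : (p'.-elt g)%g := mem_p_elt (pHall_pgroup SylS) gS.
have [t gt] : exists t, (gamma q r a ^ g = gamma q r a ^+ (p ^ t))%g.
  have : (gamma q r a ^ g)%g \in ZR by rewrite memJ_norm // ZRa cycle_id.
  case/morphimP => b _ bR /= gb.
  case: g gA gb {gS gN p'g} => -[N L] T; rewrite inE => /and4P[_ L_GL _ _] gb.
  have := conjgC (gamma q r a) (N, L, T); rewrite gb => /gamma_intertwine[_ LE _].
  have [t [_ bE _ _]] := eigen_semilinear p_pr m_gt1 cardM L_GL (primitive_full_orbit p'a) LE.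
  exists t; have -> : b = (a ^+ (p ^ t))%g by apply: val_inj; rewrite FinRing.val_unitX.
  by rewrite (morphX (gamma_morphism M q r)) ?inE.
have gnt n : (gamma q r a ^ (g ^+ n) = gamma q r a ^+ (p ^ (t * n)))%g.
  elim: n => [|n IH]; first by rewrite muln0 expg0 conjg1 expg1.
  by rewrite expgSr conjgM IH conjXg gt -expgM -expnD mulnS.
(* Because z ^+ (p ^ (t * m)) = z in M. *)
have gm : commute (gamma q r a) (g ^+ m)%g.
  apply/commgP/conjg_fixP; rewrite gnt -(morphX (gamma_morphism M q r)) ?inE //.
  congr (gamma q r _); apply: val_inj; rewrite FinRing.val_unitX.
  by rewrite (eq_frob cardM (j := 0)) ?modnMl ?mod0n ?expr1 ?modnMr.
have cop_g : coprime #[g]%g m.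
  have /p_natP[n ->] := p'g; apply: coprimeXl.
  exact: (primitive_divisor_coprime_exponent p_pr m_gt1 p'P).
have ggm : g \in <[g ^+ m]>%g.
  by have /eqP<- : generator <[g]> (g ^+ m)%g; rewrite ?generator_coprime ?cycle_id.
have /cycleP[n ->] := ggm.
apply/setIP; split; first by rewrite !groupX.
rewrite ZRa /= cent_cycle; apply/cent1P.
exact/commute_sym/commuteX.
Qed.

(** If [d] is any isotopism, the conjugate by [d] of the torus of [P2] is a
    [p']-group of autotopisms of [P1], which some autotopism [x] moves into the
    Sylow subgroup [Z_R]; then [x^-1 * d] is the isotopism sought.  It suffices to
    follow a generator [b] of [R]: its image [a] is not [1], and has order a power
    of [p']. *)
Lemma intertwining_isotopism k1 l1 k2 l2 (P1 P2 : presemifield V) :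
  (p'.-Sylow(autotopisms p P1) (Z_gamma (p ^ k1) (p ^ l1) R))%g ->
  biprojective_presemifield (p ^ k2) (p ^ l2) P2 -> isotopic p P1 P2 ->
  exists g a b,
    [/\ isotopism p P1 P2 g, (p'.-elt a)%g, (p' %| #[a]%g)%N
      & (gamma (p ^ k1) (p ^ l1) a * g = g * gamma (p ^ k2) (p ^ l2) b)%g].
Proof.
move=> SylZ P2P [d dP]; case: (p'P) => p'_pr _ _.
have [b [Rb p'b]] := Sylow_units_generator.
pose A := autotopism_group p P1.
pose ZR := (gamma_morphism M (p ^ k1) (p ^ l1) @* R)%G.
pose g2 := gamma (p ^ k2) (p ^ l2) b.
have b_elt : (p'.-elt b)%g.
  by apply: mem_p_elt (pHall_pgroup R_Sylow) _; rewrite Rb cycle_id.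
have sQA : <[g2 ^ d^-1]>%G \subset A.
  rewrite cycle_subG inE /conjg invgK.
  apply: isotopismM dP (isotopismM _ (isotopismV dP)).
  by have := gamma_autotopism b P2P; rewrite inE.
have p'Q : (p'.-group <[g2 ^ d^-1]>)%g.
  rewrite -[(_.-group _)%g]/((p'.-elt (g2 ^ d^-1))%g) p_eltJ.
  by apply: (morph_p_elt (gamma_morphism M (p ^ k2) (p ^ l2))); rewrite ?inE.
have [x xA] := Sylow_Jsub (SylZ : (p'.-Sylow(A) ZR)%g) sQA p'Q.
rewrite -cycleJ cycle_subG => /morphimP[a _ aR /= ga].
have a_elt : (p'.-elt a)%g by apply: mem_p_elt (pHall_pgroup R_Sylow) aR.
exists (x^-1 * d)%g, a, b; split=> //.
- by apply: isotopismM dP; apply: isotopismV; rewrite inE in xA.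
- have /p_natP[[|n] an] := a_elt; last by rewrite an expnS dvdn_mulr.
  move/eqP: an; rewrite order_eq1 => /eqP a1; move: ga.
  rewrite a1 (morph1 (gamma_morphism M (p ^ k1) (p ^ l1))) => /eqP.
  rewrite !conjg_eq1 => /eqP[_ b1 _]; move: p'b.
  suff -> : b = 1%g by rewrite order1 dvdn1 => /eqP p'1; move: p'_pr; rewrite p'1.
  apply: val_inj; have /permP/(_ (1, 1)) := b1.
  by rewrite diagE perm1 => -[] /=; rewrite mulr1.
- rewrite -ga -conjgM /conjg invMg invgK !mulgA.
  by rewrite mulgK mulgKV.
Qed.

End Autotopisms.

(** * Isotopisms of biprojective pre-semifields *)

Lemma not_opp_mod_self m k : (1 <= k <= m)%N -> (k != 0 %[mod m])%N ->
  (~~ odd m -> (k != m./2 %[mod m])%N) -> ~~ opp_mod m k k.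
Proof.
move=> /andP[k_gt0 le_km] nk0k nkh; apply/negP; rewrite /opp_mod addnn.
have m_gt0 : (0 < m)%N := leq_trans k_gt0 le_km.
have lt_km : (k < m)%N.
  by rewrite ltn_neqAle le_km andbT; apply: contraNneq nk0k => ->; rewrite modnn mod0n.
case: (ltnP k.*2 m) => [lt2|le2].
  by rewrite !modn_small // double_eq0 eqn0Ngt k_gt0.
rewrite -{1}(subnK le2) modnDr !modn_small //; last first.
  by rewrite ltn_subLR // -addnn (ltn_trans (n := k + m)) ?ltn_add2l ?ltn_add2r.
rewrite subn_eq0 => le2'; have em : m = k.*2 by apply/eqP; rewrite eqn_leq le2 le2'.
by move: nkh; rewrite em odd_double doubleK eqxx => /(_ isT).
Qed.

Lemma pm_mod_trans m k l j : pm_mod m k j -> pm_mod m l j -> pm_mod m k l.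
Proof.
have opp_eq a b : opp_mod m a j -> opp_mod m b j -> (a == b %[mod m])%N.
  by rewrite /opp_mod => /eqP h /eqP h'; rewrite -(eqn_modDr j) h h'.
have eq_opp a b : (a == j %[mod m])%N -> opp_mod m b j -> opp_mod m a b.
  by rewrite /opp_mod (addnC b) => /eqP h; rewrite -(modnDml a) h modnDml.
rewrite /pm_mod => /orP[h|h] /orP[h'|h']; apply/orP.
- by left; rewrite (eqP h) (eqP h').
- by right; apply: eq_opp.
- by right; rewrite /opp_mod addnC; apply: eq_opp.
- by left; apply: opp_eq.
Qed.

Theorem theorem5p10 (p m p' : nat) (M : finFieldType)
    (R : {group {unit M}}) (k1 l1 k2 l2 : nat)
    (P1 P2 : presemifield (M * M)%type) :
  prime p -> odd p -> (2 < m)%N -> #|M| = (p ^ m)%N ->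
  primitive_divisor p m p' ->
  (p'.-Sylow([set: {unit M}]) R)%g ->
  (1 <= k1 <= m)%N -> (1 <= l1 <= m)%N ->
  (1 <= k2 <= m)%N -> (1 <= l2 <= m)%N ->
  biprojective_presemifield (p ^ k1)%N (p ^ l1)%N P1 ->
  biprojective_presemifield (p ^ k2)%N (p ^ l2)%N P2 ->
  ~~ pm_mod m k1 l1 ->
  (k1 != 0 %[mod m])%N -> (l1 != 0 %[mod m])%N ->
  (~~ odd m -> (k1 != m./2 %[mod m])%N /\ (l1 != m./2 %[mod m])%N) ->
  Z_gamma (p ^ k1)%N (p ^ l1)%N [set: {unit M}]
    \subset C_gamma p (p ^ k1)%N (p ^ l1)%N R P1 ->
  ~~ (p' %| #|C_gamma p (p ^ k1)%N (p ^ l1)%N R P1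
              : Z_gamma (p ^ k1)%N (p ^ l1)%N [set: {unit M}]|%g)%N ->
  isotopic p P1 P2 ->
  exists (N L T : {perm (M * M)%type}) (t : nat),
    [/\ isotopism p P1 P2 (N, L, T), (t <= m.-1)%N,
        [/\ nonzero_monomials p N, nonzero_monomials p L
          & nonzero_monomials p T],
        nonzero_monomials_deg p t L /\ nonzero_monomials_deg p t T
      & ((pm_mod m k1 k2 && pm_mod m l1 l2)
          || (pm_mod m k1 l2 && pm_mod m l1 k2))
        /\
        ([/\ [/\ zero_fun (sub2 N), zero_fun (sub3 N),
                 ~ zero_fun (sub1 N) & ~ zero_fun (sub4 N)],
             pm_mod m k1 k2, pm_mod m l1 l2,
             ((k1 == k2 %[mod m])%N -> monomial p t (sub1 N)) /\
             ((l1 == l2 %[mod m])%N -> monomial p t (sub4 N))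
           & (opp_mod m k1 k2 -> monomial p (t + k2) (sub1 N)) /\
             (opp_mod m l1 l2 -> monomial p (t + l2) (sub4 N))]
         \/
         [/\ [/\ zero_fun (sub1 N), zero_fun (sub4 N),
                 ~ zero_fun (sub2 N) & ~ zero_fun (sub3 N)],
             pm_mod m k1 l2, pm_mod m l1 k2,
             ((k1 == l2 %[mod m])%N -> monomial p t (sub3 N)) /\
             ((l1 == k2 %[mod m])%N -> monomial p t (sub2 N))
           & (opp_mod m k1 l2 -> monomial p (t + l2) (sub3 N)) /\
             (opp_mod m l1 k2 -> monomial p (t + k2) (sub2 N))])].
Proof.
move=> p_pr _ m_gt2 cardM p'P R_Syl k1m l1m _ _ P1P P2P nkl nk0 nl0 nhalf sZC p'I iso.
have m_gt1 : (1 < m)%N := ltnW m_gt2.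
have m_gt0 : (0 < m)%N := ltnW m_gt1.
have nkk : ~~ opp_mod m k1 k1 by apply: not_opp_mod_self k1m nk0 _ => /nhalf[].
have nll : ~~ opp_mod m l1 l1 by apply: not_opp_mod_self l1m nl0 _ => /nhalf[].
have nlk : ~~ pm_mod m l1 k1.
  by move: nkl; rewrite /pm_mod /opp_mod eq_sym addnC.
have SylZ := Sylow_gamma p_pr m_gt1 cardM p'P R_Syl sZC p'I.
have [[[N L] T] [a [b [gP a_elt p'a ab]]]] :=
  intertwining_isotopism p_pr m_gt1 cardM p'P R_Syl SylZ P2P iso.
have /and4P[N_GL L_GL T_GL /'forall_forallP NE] := gP.
have [Nab Lab Tab] := gamma_intertwine ab.
have full := primitive_full_orbit p_pr m_gt1 cardM p'P.
(* The order of a is a power of p', to which p ^ k + 1 is prime. *)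
have full_pow k : ~~ opp_mod m k k -> full_orbit p m (val a ^+ (p ^ k).+1).
  move=> nk; rewrite -FinRing.val_unitX; apply: full; rewrite orderXgcd.
  rewrite (_ : gcdn _ _ = 1%N) ?divn1 //; apply/eqP.
  have /p_natP[n ->] := a_elt; apply: coprimeXl.
  exact: (primitive_divisor_expS p_pr m_gt1 p'P).
have [t [lt_tm bt L_semi L_deg]] := eigen_semilinear p_pr m_gt1 cardM L_GL (full _ p'a) Lab.
have [t' [lt_t'm bt' T_semi T_deg]] :=
  eigen_semilinear p_pr m_gt1 cardM T_GL (full _ p'a) Tab.
have ett : t' = t.
  by have := full _ p'a t t'; rewrite -bt -bt' !modn_small // => ->.
rewrite {t' lt_t'm bt'}ett in T_semi T_deg.
have [D1 D2 D3 D4] := GL_sub N_GL.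
have [E1 E2 E3 E4] := GL_sub_eigen Nab.
have [c1 [j1 N1]] := eigen_power p_pr m_gt1 cardM D1 (full_pow _ nkk) E1.
have [c2 [j2 N2]] := eigen_power p_pr m_gt1 cardM D2 (full_pow _ nll) E2.
have [c3 [j3 N3]] := eigen_power p_pr m_gt1 cardM D3 (full_pow _ nkk) E3.
have [c4 [j4 N4]] := eigen_power p_pr m_gt1 cardM D4 (full_pow _ nll) E4.
have [f1 g1] := biprojective_line_form p_pr cardM P1P.
have [f2 g2] := biprojective_line_form p_pr cardM P2P.
have [f1_neq0 g1_neq0] := presemifield_components p_pr cardM P1.
have NP X U : (c1 * (P1 X U).1 ^+ (p ^ j1) + c2 * (P1 X U).2 ^+ (p ^ j2) = (P2 (L X) (T U)).1)
   /\ (c3 * (P1 X U).1 ^+ (p ^ j3) + c4 * (P1 X U).2 ^+ (p ^ j4) = (P2 (L X) (T U)).2).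
  by have := eqP (NE X U); rewrite (GL_subE N_GL) => <-; rewrite N1 N2 N3 N4.
have deg := line_form_degree p_pr m_gt1 cardM.
have deg1 (c0 : c1 != 0) := deg _ _ _ _ _ _ _ _ _ _ _ _ _ nkl nkk f1 g1 f2 L_semi T_semi
  f1_neq0 c0 (fun X U => (NP X U).1).
have deg3 (c0 : c3 != 0) := deg _ _ _ _ _ _ _ _ _ _ _ _ _ nkl nkk f1 g1 g2 L_semi T_semi
  f1_neq0 c0 (fun X U => (NP X U).2).
have deg2 (c0 : c2 != 0) := deg _ _ _ _ _ _ _ _ _ _ _ _ _ nlk nll g1 f1 f2 L_semi T_semi
  g1_neq0 c0 (fun X U => etrans (addrC _ _) (NP X U).1).
have deg4 (c0 : c4 != 0) := deg _ _ _ _ _ _ _ _ _ _ _ _ _ nlk nll g1 f1 g2 L_semi T_semi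
  g1_neq0 c0 (fun X U => etrans (addrC _ _) (NP X U).2).
have degP (k k' j : nat) :
   (k == k' %[mod m]) && (j == t %[mod m]) || opp_mod m k k' && (j == t + k' %[mod m]) ->
   pm_mod m k k'.
  by rewrite /pm_mod => /orP[/andP[-> _]|/andP[-> _]]; rewrite ?orbT.
have kl_absurd j : pm_mod m k1 j -> pm_mod m l1 j -> False.
  by move=> h h'; case/negP: nkl; apply: pm_mod_trans h h'.
(* N is injective on each axis. *)
have N10 : (c1 != 0) || (c3 != 0).
  rewrite -negb_and; apply/negP => /andP[/eqP c10 /eqP c30].
  have /(GL_neq0 N_GL)/eqP[] : (1, 0) != 0 :> (M * M)%type.
    by rewrite -pair_eqE /= oner_eq0.
  by rewrite (GL_subE N_GL) /= N1 N2 N3 N4 c10 c30 !(frob0 _ p_pr) !mulr0 !mul0r addr0.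
have N01 : (c2 != 0) || (c4 != 0).
  rewrite -negb_and; apply/negP => /andP[/eqP c20 /eqP c40].
  have /(GL_neq0 N_GL)/eqP[] : (0, 1) != 0 :> (M * M)%type.
    by rewrite -pair_eqE /= oner_eq0 andbF.
  by rewrite (GL_subE N_GL) /= N1 N2 N3 N4 c20 c40 !(frob0 _ p_pr) !mulr0 !mul0r addr0.
(* An output of N that used both inputs would give k1 = +- l1. *)
have c12 : (c1 == 0) || (c2 == 0).
  apply/norP => -[/deg1/degP h /deg2/degP]; exact: kl_absurd.
have c34 : (c3 == 0) || (c4 == 0).
  apply/norP => -[/deg3/degP h /deg4/degP]; exact: kl_absurd.
have mon (f : M -> M) c j : (forall x, f x = c * x ^+ (p ^ j)) ->
    ~ zero_fun f -> exists i, monomial p i f.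
  move=> fE f0; exists j, c => //; apply/eqP => c0; apply: f0 => x.
  by rewrite fE c0 mul0r.
have zero (f : M -> M) c j : (forall x, f x = c * x ^+ (p ^ j)) -> c = 0 -> zero_fun f.
  by move=> fE c0 x; rewrite fE c0 mul0r.
have nonzero (f : M -> M) c j : (forall x, f x = c * x ^+ (p ^ j)) -> c != 0 -> ~ zero_fun f.
  by move=> fE c0 /(_ 1) /eqP; rewrite fE expr1n mulr1 (negPf c0).
have degs (k k' j : nat) (f : M -> M) c : ~~ opp_mod m k k ->
   (forall x, f x = c * x ^+ (p ^ j)) -> c != 0 ->
   (k == k' %[mod m]) && (j == t %[mod m]) || opp_mod m k k' && (j == t + k' %[mod m]) ->
   ((k == k' %[mod m])%N -> monomial p t f) /\ (opp_mod m k k' -> monomial p (t + k') f).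
  move=> nk fE c0 h.
  have no : (k == k' %[mod m])%N -> opp_mod m k k' -> False.
    by move=> /eqP e; rewrite /opp_mod -modnDmr -e modnDmr => h'; case/negP: nk.
  case/orP: h => /andP[e /eqP ej]; split=> e'.
  - by exists c => // x; rewrite fE (eq_frob cardM _ ej).
  - by case: (no e e').
  - by case: (no e' e).
  - by exists c => // x; rewrite fE (eq_frob cardM _ ej).
exists N, L, T, t; split=> //.
- by rewrite -ltnS prednK.
- have deg_mon (K : M * M -> M * M) : nonzero_monomials_deg p t K -> nonzero_monomials p K.
    by case=> m1 m2 m3 m4; split=> h; exists t; auto.
  by split; [split; apply: mon; eassumption | apply: deg_mon..].
have [c10|c10] := eqVneq c1 0.
  move: N10 c34; rewrite c10 eqxx /= => c3_neq0; rewrite (negPf c3_neq0) /= => /eqP c40.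
  move: N01; rewrite c40 eqxx orbF => c2_neq0.
  have h2 := deg2 c2_neq0; have h3 := deg3 c3_neq0.
  have [h2t h2o] := degs _ _ _ _ _ nll N2 c2_neq0 h2.
  have [h3t h3o] := degs _ _ _ _ _ nkk N3 c3_neq0 h3.
  rewrite (degP _ _ _ h3) (degP _ _ _ h2) orbT; split=> //; right; split=> //.
  by split; [apply: zero N1 c10 | apply: zero N4 c40 | apply: nonzero N2 _
    | apply: nonzero N3 _].
move: c12; rewrite (negPf c10) /= => /eqP c20.
move: N01 c34; rewrite c20 eqxx /= => c4_neq0; rewrite (negPf c4_neq0) orbF => /eqP c30.
have h1 := deg1 c10; have h4 := deg4 c4_neq0.
have [h1t h1o] := degs _ _ _ _ _ nkk N1 c10 h1.
have [h4t h4o] := degs _ _ _ _ _ nll N4 c4_neq0 h4.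
rewrite (degP _ _ _ h1) (degP _ _ _ h4); split=> //; left; split=> //.
by split; [apply: zero N2 c20 | apply: zero N3 c30 | apply: nonzero N1 _
  | apply: nonzero N4 _].
Qed.
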